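(* Let $n$ be a positive integer and suppose that there exists a strongly regular graph with parameters $((n^2+3n-1)^2,\ n^2(n+3),\ 1,\ n(n+1))$. Then $n\in\{1,2,4\}$.
   Context: A strongly regular graph with parameters $(v,k,\lambda,\mu)$ is a finite simple undirected graph on $v$ vertices which is regular of valency $k$, such that each pair of (distinct) adjacent vertices has exactly $\lambda$ common neighbors and each pair of distinct nonadjacent vertices has exactly $\mu$ common neighbors. *)

(* Defs.v *)
From mathcomp Require Export all_boot.

Set Implicit Arguments.
Unset Strict Implicit.
Unset Printing Implicit Defensive.

(* A finite simple undirected graph on the vertex type T is given by its
   adjacency relation e. No nondegeneracy (connectedness, noncompleteness, ...)
   is required. *)
Record strongly_regular (T : finType) (e : rel T) (v k lambda mu : nat) : Prop :=
  StronglyRegular {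
    srg_sym : symmetric e;
    srg_irrefl : irreflexive e;
    srg_order : #|T| = v;
    srg_valency : forall x : T, #|[set y | e x y]| = k;
    srg_adj : forall x y : T, x != y -> e x y ->
      #|[set z | e x z && e y z]| = lambda;
    srg_nonadj : forall x y : T, x != y -> ~~ e x y ->
      #|[set z | e x z && e y z]| = mu
  }.

(* Main.v *)
(* Put m = n^2 + 3n - 1, so v = m^2, and H = n I - A + (n/m) J.  Then H^2 = m H:
   up to scaling H is the Gram matrix of the projections of the vertices to the
   eigenspace of A for the smallest eigenvalue n - m.  Since lambda = 1, the
   neighbours of a vertex x are paired off by the triangles through x.  For a
   vertex y not adjacent to x, the vector of y is an explicit combination of
   those of x and its neighbours.  Swapping paired neighbours in this
   combination gives a vector of the same norm, and a local norm computation
   with integrality forces it, for n >= 3, to be the vector of a vertex, the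
   reflection of y in x.
   Reflections are automorphisms, and the reflection of y in x equals that of x
   in y; hence for adjacent x, a the product of the two reflections moves every
   vertex to a neighbour.  Automorphisms with this property are determined by
   the image of one vertex, commute and have order 3, so the vertices form an
   orbit of an abelian 3-group and m is a power of 3.  Finally m = 3^t means
   (2n+3)^2 = 4 * 3^t + 13; for even t the right-hand side minus 13 is a
   square, and for odd t one is left with X^2 - 12 Y^2 = 13, Y a power of 3,
   whose solutions are controlled modulo 333. *)
Require Import Defs.
From mathcomp Require Import all_boot all_order all_algebra all_fingroup.
From mathcomp Require Import all_solvable ring lra zify.

Set Implicit Arguments.
Unset Strict Implicit.
Unset Printing Implicit Defensive.

Import Order.TTheory GRing.Theory Num.Theory.

(** * Powers of 3 of the form n^2 + 3n - 1 *)

(** Multiplication of X + Y sqrt 12 by the unit 7 + 2 sqrt 12, of norm 1, modulo 333 = 9 * 37. *)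
Definition pell_step (p : nat * nat) : nat * nat :=
  ((7 * p.1 + 24 * p.2) %% 333, (2 * p.1 + 7 * p.2) %% 333).

(** Seeds for the solutions of X^2 - 12 Y^2 = 13: (5, 1), and (11, 3), the image of (5, -1). *)
Definition pell_orbit : seq (nat * nat) :=
  traject pell_step (5, 1) 18 ++ traject pell_step (11, 3) 18.

Definition pow3_residues : seq nat := traject (fun x => (3 * x) %% 333) 9 18.

Lemma pell_orbit_closed : all (fun p => pell_step p \in pell_orbit) pell_orbit.
Proof. by vm_compute. Qed.

(** Descent by the inverse unit: (7 X - 24 Y, 7 Y - 2 X) is a smaller solution until Y < 8, where
    solutions are enumerated. *)
Lemma pell_orbitP (X Y : nat) :
  X ^ 2 = 12 * Y ^ 2 + 13 -> (X %% 333, Y %% 333) \in pell_orbit.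
Proof.
elim/ltn_ind: Y X => Y IH X hXY.
have [Y8|Y8] := leqP 8 Y; last first.
  have hX : X < 26.
    rewrite -(ltn_exp2r _ _ (isT : 0 < 2)) hXY.
    have : Y ^ 2 <= 7 ^ 2 by rewrite leq_exp2r.
    by lia.
  have chk : all (fun y => all (fun x => (x ^ 2 == 12 * y ^ 2 + 13) ==>
     ((x %% 333, y %% 333) \in pell_orbit)) (iota 0 26)) (iota 0 8).
    by vm_compute.
  have Yi : Y \in iota 0 8 by rewrite mem_iota.
  have Xi : X \in iota 0 26 by rewrite mem_iota.
  by move/eqP: hXY; apply/implyP; apply: (allP (allP chk _ Yi) _ Xi).
have Y2 : 8 ^ 2 <= Y ^ 2 by rewrite leq_exp2r.
(* This amounts to 48 Y^2 + 52 < 49 Y^2, which holds exactly from Y = 8 on. *)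
have h1 : 2 * X < 7 * Y.
  by rewrite -(ltn_exp2r _ _ (isT : 0 < 2)) !expnMn; lia.
have h2 : 6 * Y < 2 * X.
  by rewrite -(ltn_exp2r _ _ (isT : 0 < 2)) !expnMn; lia.
have h3 : 24 * Y < 7 * X.
  by rewrite -(ltn_exp2r _ _ (isT : 0 < 2)) !expnMn; lia.
have [X' eX'] : exists X', 7 * X = X' + 24 * Y by exists (7 * X - 24 * Y); lia.
have [Y' eY'] : exists Y', 7 * Y = Y' + 2 * X by exists (7 * Y - 2 * X); lia.
have lt : Y' < Y by lia.
have eX : X = 7 * X' + 24 * Y' by lia.
have eY : Y = 2 * X' + 7 * Y' by lia.
have eqn : X' ^ 2 = 12 * Y' ^ 2 + 13.
  by move: hXY; rewrite eX eY !expnS !expn0; lia.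
move: (allP pell_orbit_closed _ (IH _ lt _ eqn)).
rewrite /pell_step /= -[in X in X -> _]modnDm !modnMmr modnDm.
by rewrite -[in X in X -> _](modnDm (2 * _)) !modnMmr modnDm -eX -eY.
Qed.

Lemma pow3_residuesP (j : nat) : 3 ^ j.+2 %% 333 \in pow3_residues.
Proof.
elim: j => [|j IH]; first by vm_compute.
have closed : all (fun x => (3 * x) %% 333 \in pow3_residues) pow3_residues.
  by vm_compute.
by move: (allP closed _ IH); rewrite modnMmr -expnS.
Qed.

(** From 3^2 on, the residues of powers of 3 modulo 333 miss the second coordinates of the orbit; Y
    = 1 and Y = 3 are the seeds. *)
Lemma pell_pow3 (X j : nat) : X ^ 2 = 12 * (3 ^ j) ^ 2 + 13 -> j <= 1.
Proof.
case: j => [|[|j]] // /pell_orbitP h.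
have disj : all (fun p => p.2 \notin pow3_residues) pell_orbit by vm_compute.
by move: (allP disj _ h); rewrite /= pow3_residuesP.
Qed.

Lemma quadratic_pow3 (n t : nat) :
  0 < n -> n ^ 2 + 3 * n - 1 = 3 ^ t -> n \in [:: 1; 2; 4].
Proof.
move=> n0 h; have sq : (2 * n + 3) ^ 2 = 4 * 3 ^ t + 13.
  by rewrite -h -!mulnn; nia.
have uniq a b : (2 * a + 3) ^ 2 = (2 * b + 3) ^ 2 -> a = b.
  by move=> /eqP; rewrite eqn_exp2r // => /eqP; lia.
move: sq; have := odd_double_half t; case: (odd t) => /= <-;
  rewrite -muln2 expnD expnM; set y := 3 ^ t./2 => sq.
- have h2 : (2 * n + 3) ^ 2 = 12 * y ^ 2 + 13 by rewrite sq; lia.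
  have := pell_pow3 h2; move: h2; rewrite /y; case: t./2 => [|[|j]] // h2 _.
    by rewrite (uniq n 1).
  by rewrite (uniq n 4).
- have h2 : (2 * n + 3 - 2 * y) * (2 * n + 3 + 2 * y) = 13.
    by rewrite -subn_sqr sq expnMn expn0; lia.
  have dv : 2 * n + 3 + 2 * y \in divisors 13.
    by rewrite -dvdn_divisors // -[in X in _ %| X]h2 dvdn_mull.
  move: dv; rewrite !inE; case/orP => /eqP dv; first by lia.
  have -> : n = 2 by move: h2; rewrite dv; lia.
  by [].
Qed.

(** * The graph *)

Section Graph.

Local Open Scope ring_scope.

Lemma sum_indicator (T : finType) (P : pred T) (i : T) :
  P i -> \sum_(u | P u) (u == i)%:R = 1 :> rat.
Proof.
move=> Pi; rewrite (bigD1 i) //= eqxx big1 ?addr0 // => u /andP[_ /negPf->] //.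
Qed.

Lemma delta_subr_eq (q : rat) (a b : bool) :
  3 <= q -> q * a%:R - b%:R = q * true%:R - false%:R -> a.
Proof. by case: a b => [] [] //= *; lra. Qed.

Lemma muln_add_eqS (n a b : nat) : (2 < n)%N -> (0 < a)%N -> (0 < b)%N ->
  (n * a + b = n.+1)%N -> a = 1%N /\ b = 1%N.
Proof.
move=> n2; case: a => // [[|a]] _ b0 h; first by lia.
by move: h; rewrite !mulnS; lia.
Qed.

(** Reduces an identity that follows from one equation to a check by [ring] or [field]. *)
Lemma eq_of_sub (R : zmodType) (a b c d : R) : c = d -> a - b = d - c -> a = b.
Proof. by move=> -> /eqP; rewrite subrr subr_eq0 => /eqP. Qed.

Lemma sum_indicatorM (T : finType) (F : T -> rat) (i : T) :
  \sum_u (u == i)%:R * F u = F i.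
Proof.
rewrite (bigD1 i) //= eqxx mul1r big1 ?addr0 // => u /negPf->.
by rewrite mul0r.
Qed.

Variables (T : finType) (e : rel T) (n : nat).
Hypothesis n_gt2 : (2 < n)%N.
Hypothesis srg : strongly_regular e ((n ^ 2 + 3 * n - 1) ^ 2)
  (n ^ 2 * (n + 3)) 1 (n * (n + 1)).

Local Notation N := (n%:R : rat).
Local Notation m := (N ^+ 2 + 3 * N - 1).
Local Notation k := (N ^+ 2 * (N + 3)).
Local Notation mu := (N * (N + 1)).
Local Notation A x y := ((e x y)%:R : rat).

Let eC x y : e x y = e y x. Proof. by case: srg => + _ _ _ _ _; apply. Qed.
Let eI x : e x x = false. Proof. by case: srg => _ + _ _ _ _; apply. Qed.

Let N_ge3 : 3 <= N.
Proof. by rewrite (ler_nat _ 3). Qed.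

Let m_gt0 : 0 < m.
Proof. move: N_ge3 => h; nra. Qed.

Let m_neq0 : m != 0.
Proof. by rewrite gt_eqF. Qed.

Let N2_neq0 : N ^+ 2 - 1 != 0.
Proof. by move: N_ge3 => h; rewrite gt_eqF //; nra. Qed.

Lemma order_rat : \sum_(x : T) 1 = m ^+ 2 :> rat.
Proof.
rewrite sumr_const (srg_order srg) natrX natrB.
  by rewrite natrD natrM natrX.
by apply: leq_trans (leq_addl _ _); rewrite muln_gt0 /= (leq_trans _ n_gt2).
Qed.

Lemma sum_bool (P : pred T) : \sum_x (P x)%:R = #|[set x | P x]|%:R :> rat.
Proof.
rewrite -sum1dep_card natr_sum [RHS]big_mkcond /=.
by apply: eq_bigr => x _; case: (P x).
Qed.

Lemma sum_adj x : \sum_y A x y = k.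
Proof. by rewrite sum_bool (srg_valency srg) natrM natrX natrD. Qed.

Lemma sum_adj2 x y : \sum_z A x z * A y z =
  (x == y)%:R * k + A x y + (1 - (x == y)%:R - A x y) * mu.
Proof.
under eq_bigr => z _ do rewrite -natrM mulnb.
case: (eqVneq x y) => [<-|xy].
  under eq_bigr => z _ do rewrite andbb.
  by rewrite sum_adj eI /=; ring.
rewrite sum_bool; case: (boolP (e x y)) => exy.
  by rewrite (srg_adj srg) //=; ring.
by rewrite (srg_nonadj srg) //= natrM natrD; ring.
Qed.

(** * The pairing of the neighbours of a vertex by triangles *)

Definition mate x u := odflt x [pick z | e x z && e u z].

(** On an edge the default in [mate] is never reached, since lambda = 1 provides a third vertex. *)
Lemma mate_adj x u : e x u -> e x (mate x u) && e u (mate x u).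
Proof.
move=> xu; rewrite /mate; case: pickP => //= h.
have xneu : x != u by apply: contraTneq xu => ->; rewrite eI.
have := srg_adj srg xneu xu.
by rewrite (_ : [set z | _] = set0) ?cards0 //; apply/setP => z; rewrite !inE h.
Qed.

Lemma mate_uniq x u z : e x u -> e x z -> e u z -> z = mate x u.
Proof.
move=> xu xz uz.
have xneu : x != u by apply: contraTneq xu => ->; rewrite eI.
have /eqP/cards1P[w hw] := srg_adj srg xneu xu.
have : z \in [set w] by rewrite -hw inE xz.
have : mate x u \in [set w] by rewrite -hw inE mate_adj.
by rewrite !inE => /eqP-> /eqP->.
Qed.

Lemma mate_adjl x u : e x u -> e x (mate x u).
Proof. by case/mate_adj/andP. Qed.

Lemma mate_adjr x u : e x u -> e u (mate x u).
Proof. by case/mate_adj/andP. Qed.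

Lemma mateC x u : e x u -> mate x u = mate u x.
Proof. by move=> xu; apply: mate_uniq; rewrite ?mate_adjl ?mate_adjr // eC. Qed.

Lemma mateK x u : e x u -> mate x (mate x u) = u.
Proof.
by move=> xu; apply/esym/mate_uniq; rewrite ?mate_adjl // eC mate_adjr.
Qed.

Lemma mate_mate x u : e x u -> mate (mate x u) u = x.
Proof.
move=> xu; apply/esym/mate_uniq; rewrite eC ?mate_adjl ?mate_adjr //.
Qed.

Lemma adj_mate x u v : e x u -> e x v -> e u v = (v == mate x u).
Proof.
move=> xu xv; apply/idP/eqP => [uv|->]; last exact: mate_adjr.
exact: mate_uniq.
Qed.

Lemma adj_mate2 x u v : e x u -> e x v -> e (mate x u) (mate x v) = e u v.
Proof.
move=> xu xv; rewrite (adj_mate (mate_adjl xu) (mate_adjl xv)) (adj_mate xu xv).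
rewrite mateK //.
apply/eqP/eqP => [<-|->]; last exact: mateK.
by rewrite mateK.
Qed.

Lemma eq_mate2 x u v : e x u -> e x v -> (mate x u == mate x v) = (u == v).
Proof.
move=> xu xv; apply/eqP/eqP => [h|-> //].
by rewrite -(mateK xu) h mateK.
Qed.

Lemma sum_mate x (F : T -> rat) :
  \sum_(u | e x u) F (mate x u) = \sum_(u | e x u) F u.
Proof.
rewrite [RHS](reindex_onto (mate x) (mate x) (@mateK x)).
apply/esym/eq_bigl => u; apply/andP/idP => [[h /eqP<-]|h].
  exact: mate_adjl.
by rewrite mate_adjl // mateK.
Qed.

(** The edge from u to [mate x u] lies in only one triangle, and its third vertex is x. *)
Lemma nonadj_mate x y u : x != y -> e x u -> e y u -> e y (mate x u) = false.
Proof.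
move=> xy xu yu; apply: contraNF xy => h; apply/eqP.
have a : e (mate x u) u by rewrite eC mate_adjr.
rewrite -(mate_mate xu); apply/esym/mate_uniq => //; by rewrite eC.
Qed.

Lemma nonadj_common x y u v :
  x != y -> e x u -> e y u -> e x v -> e y v -> e u v = false.
Proof.
move=> xy xu yu xv yv; rewrite (adj_mate xu xv).
by apply: contraTF yv => /eqP->; rewrite nonadj_mate.
Qed.

(** ** The smallest eigenspace *)

Definition eigenfun (f : T -> rat) :=
  \sum_z f z = 0 /\ forall x, \sum_z A x z * f z = (N - m) * f x.

(** The entries of H; [gram y] plays the role of the vector of y. *)
Definition gram y z : rat := N * (z == y)%:R - A y z + N / m.

Lemma gramC x y : gram x y = gram y x.
Proof. by rewrite /gram eq_sym eC. Qed.

Lemma eigenfun_gram y : eigenfun (gram y).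
Proof.
split=> [|x]; rewrite /gram.
  rewrite big_split sumrB /= -mulr_sumr sum_indicator // sum_adj.
  by rewrite -[N / m]mulr1 -mulr_sumr order_rat; field.
rewrite (eq_bigr (fun z => N * ((z == y)%:R * A x z) - A x z * A y z
  + N / m * A x z)); last by move=> z _; ring.
rewrite big_split sumrB /= -!mulr_sumr sum_indicatorM sum_adj sum_adj2.
rewrite (eC y x); by field.
Qed.

(** H acts on the eigenspace as the scalar m, so pairing with [gram y] evaluates at y, up to m. *)
Lemma gram_reproducing f y : eigenfun f -> \sum_z gram y z * f z = m * f y.
Proof.
case=> f0 fA; rewrite /gram.
rewrite (eq_bigr (fun z => N * ((z == y)%:R * f z) - A y z * f z
  + N / m * f z)); last by move=> z _; ring.
rewrite big_split sumrB /= -!mulr_sumr sum_indicatorM f0 fA; ring.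
Qed.

Lemma eigenfunD f g : eigenfun f -> eigenfun g -> eigenfun (fun z => f z + g z).
Proof.
move=> [f0 fA] [g0 gA]; split=> [|x]; first by rewrite big_split /= f0 g0 addr0.
by under eq_bigr => z _ do rewrite mulrDr; rewrite big_split /= fA gA; ring.
Qed.

Lemma eigenfunZ c f : eigenfun f -> eigenfun (fun z => c * f z).
Proof.
move=> [f0 fA]; split=> [|x]; first by rewrite -mulr_sumr f0 mulr0.
under eq_bigr => z _ do rewrite mulrCA.
by rewrite -mulr_sumr fA; ring.
Qed.

Lemma eigenfun_sum (P : pred T) (f : T -> T -> rat) :
  (forall u, P u -> eigenfun (f u)) -> eigenfun (fun z => \sum_(u | P u) f u z).
Proof.
move=> fP; split=> [|x]; first by rewrite exchange_big big1 // => u /fP[].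
under eq_bigr => z _ do rewrite mulr_sumr.
by rewrite exchange_big mulr_sumr; apply: eq_bigr => u /fP[_ /=->].
Qed.

(** The linear relation between y, x and the neighbours of x: for y far from x it will vanish on the
    whole eigenspace. *)
Definition comb x y (f : T -> rat) : rat :=
  (N ^+ 2 - 1) * f y + N * (N + 1) * f x +
  \sum_(u | e x u && e y u) (N * f u + f (mate x u)).

Lemma eigenfun_comb x y : eigenfun (fun z => comb x y (gram^~ z)).
Proof.
apply: eigenfunD; first by apply: eigenfunD; apply/eigenfunZ/eigenfun_gram.
apply: eigenfun_sum => u _; apply: eigenfunD; last exact: eigenfun_gram.
exact/eigenfunZ/eigenfun_gram.
Qed.

Lemma comb_pairing x y f : eigenfun f ->
  \sum_z comb x y (gram^~ z) * f z = m * comb x y f.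
Proof.
move=> fE; rewrite /comb.
under eq_bigr => z _ do rewrite !mulrDl mulr_suml -!mulrA.
rewrite !big_split /= exchange_big -!mulr_sumr !(gram_reproducing _ fE).
rewrite !mulrDr; congr (_ + _); first by ring.
rewrite (eq_bigr (fun u => m * (N * f u) + m * f (mate x u))) => [|u _].
  by rewrite big_split /= -!mulr_sumr.
under eq_bigr => z _ do rewrite mulrDl -mulrA.
rewrite big_split /= -mulr_sumr !(gram_reproducing _ fE); ring.
Qed.

Lemma sum_common x y c : x != y -> ~~ e x y ->
  \sum_(u | e x u && e y u) c = mu * c.
Proof.
move=> xy nxy; rewrite sumr_const -cardsE (srg_nonadj srg) //.
by rewrite -[c *+ _]mulr_natl natrM natrD.
Qed.

(** The coefficients of [comb] add up to (n + 1) m, so the J part of H contributes n (n + 1). *)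
Lemma comb_gramE x y z : x != y -> ~~ e x y ->
  comb x y (gram^~ z) = (N ^+ 2 - 1) * (N * (z == y)%:R - A y z)
   + N * (N + 1) * (N * (z == x)%:R - A x z) + N * (N + 1)
   + \sum_(u | e x u && e y u) (N * (N * (z == u)%:R - A u z)
                             + (N * (z == mate x u)%:R - A (mate x u) z)).
Proof.
move=> xy nxy; rewrite /comb /gram.
rewrite (eq_bigr (fun u => (N * (N * (z == u)%:R - A u z)
  + (N * (z == mate x u)%:R - A (mate x u) z)) + (N + 1) * (N / m)));
  last by move=> u _; ring.
rewrite big_split /= sum_common //; by field.
Qed.

(* A combination of rows of the Gram matrix that vanishes where its
   coefficients are supported has norm zero. *)
Lemma comb_gram_eq0 x y : x != y -> ~~ e x y ->
  forall z, comb x y (gram^~ z) = 0.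
Proof.
move=> xy nxy; set phi := fun z => comb x y (gram^~ z).
have yx : y != x by rewrite eq_sym.
have phiy : phi y = 0.
  rewrite /phi comb_gramE // eqxx eI (negPf yx) (negPf nxy).
  rewrite (eq_bigr (fun=> - N)) ?sum_common //; first by rewrite /=; ring.
  move=> u /andP[xu yu]; rewrite (eC u) yu (eC _ y) nonadj_mate //.
  have -> : y == u = false by apply: contraTF yu => /eqP<-; rewrite eI.
  have -> : y == mate x u = false.
    by apply: contraNF nxy => /eqP->; rewrite mate_adjl.
  by rewrite /=; ring.
have phix : phi x = 0.
  rewrite /phi comb_gramE // eqxx eI (negPf xy) (eC y) (negPf nxy).
  rewrite (eq_bigr (fun=> - N - 1)) ?sum_common //; first by rewrite /=; ring.
  move=> u /andP[xu yu]; rewrite (eC u) xu (eC _ x) mate_adjl //.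
  have -> : x == u = false by apply: contraTF xu => /eqP<-; rewrite eI.
  have -> : x == mate x u = false.
    by apply: contraTF (mate_adjl xu) => /eqP<-; rewrite eI.
  by rewrite /=; ring.
have phiu u : e x u && e y u -> phi u = 0.
  case/andP=> xu yu; rewrite /phi comb_gramE // xu yu.
  have -> : u == y = false by apply: contraTF yu => /eqP->; rewrite eI.
  have -> : u == x = false by apply: contraTF xu => /eqP->; rewrite eI.
  (* Common neighbours are pairwise nonadjacent, and [mate x v] is adjacent to u only if v = u, so a
     single term survives. *)
  rewrite (eq_bigr (fun v => (N ^+ 2 - 1) * (v == u)%:R)).
    by rewrite -mulr_sumr sum_indicator ?xu //=; ring.
  move=> v /andP[xv yv]; rewrite (nonadj_common xy xv yv xu yu).
  rewrite (adj_mate (mate_adjl xv) xu) mateK // (eq_sym u v).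
  have -> : u == mate x v = false.
    by apply: contraTF yu => /eqP->; rewrite nonadj_mate.
  by rewrite /=; ring.
have phiM u : e x u && e y u -> phi (mate x u) = 0.
  case/andP=> xu yu; rewrite /phi comb_gramE // mate_adjl // nonadj_mate //.
  have -> : mate x u == y = false.
    by apply: contraNF nxy => /eqP<-; rewrite mate_adjl.
  have -> : mate x u == x = false.
    by apply: contraTF (mate_adjl xu) => /eqP->; rewrite eI.
  rewrite (eq_bigr (fun v => 0 * (v == u)%:R)).
    by rewrite -mulr_sumr sum_indicator ?xu //=; ring.
  move=> v /andP[xv yv]; rewrite adj_mate2 // (nonadj_common xy xv yv xu yu).
  rewrite eq_mate2 // (adj_mate xv (mate_adjl xu)) eq_mate2 // (eq_sym u).
  have -> : mate x u == v = false.
    by apply: contraTF yv => /eqP<-; rewrite nonadj_mate.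
  by rewrite /=; ring.
have phi0 : comb x y phi = 0.
  rewrite /comb phiy phix big1 ?mulr0 ?addr0 // => u hu.
  by rewrite phiu // phiM // mulr0 addr0.
have : \sum_z phi z * phi z = 0.
  by rewrite [LHS](comb_pairing x y (eigenfun_comb x y)) phi0 mulr0.
move/eqP; rewrite psumr_eq0 => [/allP h z|z _]; last exact: sqr_ge0.
by apply/eqP; have := h z (mem_index_enum z); rewrite mulf_eq0 orbb.
Qed.

Lemma eigenfun_star x y f : eigenfun f -> x != y -> ~~ e x y ->
  comb x y f = 0.
Proof.
move=> fE xy nxy; apply/eqP; rewrite -(mulrI_eq0 _ (mulfI m_neq0)).
rewrite -comb_pairing // big1 // => z _.
by rewrite comb_gram_eq0 // mul0r.
Qed.

(** ** Overlaps and existence of reflections *)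

(** For y and z far from x, this is minus the sum left in [comb_gramE]; its value then depends only
    on whether y and z are equal, adjacent or neither. *)
Definition overlap x y z : rat :=
  \sum_(u | e x u) A y u * (N * A z u + A z (mate x u)).

Lemma overlapE x y z : x != y -> ~~ e x y -> x != z -> ~~ e x z ->
  overlap x y z = N * (N + 1) + (N ^+ 2 - 1) * (N * (y == z)%:R - A y z).
Proof.
move=> xy nxy xz nxz; have := comb_gram_eq0 xy nxy z.
rewrite comb_gramE // (eq_sym z x) (negPf xz) (negPf nxz) (eq_sym z).
suff -> : \sum_(u | e x u && e y u) (N * (N * (z == u)%:R - A u z) +
   (N * (z == mate x u)%:R - A (mate x u) z)) = - overlap x y z.
  move=> h; rewrite -[LHS]addr0 -h /=; ring.
rewrite /overlap -sumrN big_mkcondr; apply: eq_bigr => u xu.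
have -> : z == u = false by apply: contraNF nxz => /eqP->.
have -> : z == mate x u = false.
  by apply: contraNF nxz => /eqP->; apply: mate_adjl.
rewrite (eC u) (eC _ z); case: (e y u) => /=; ring.
Qed.

(** For z far from w, [eigenfun_star] reads (n^2 - 1) f z = - (c + P z), with P z a sum over the
    common neighbours of w and z. The squares of c + P are summed over all z, and the terms at w and
    its neighbours are removed. *)
Lemma eigenfun_local_norm f w : eigenfun f ->
  (N ^+ 2 - 1) ^+ 2 * (\sum_z f z ^+ 2) =
  ((N ^+ 2 - 1) ^+ 2 + N ^+ 2 * (N + 1) ^+ 2 * (m ^+ 2 - k - 1)
   + 2 * N * (N + 1) ^+ 2 * (k - 2) * (N - m)
   + (mu - 1) * (N + 1) ^+ 2 * (N - m) ^+ 2) * f w ^+ 2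
  + m * (N ^+ 2 - 1) * (N * (\sum_(z | e w z) f z ^+ 2)
                        + \sum_(z | e w z) f z * f (mate w z)).
Proof.
move=> fE; have [f0 fA] := fE.
have [chi chiE] : exists chi : T -> rat,
    forall u, chi u = N * f u + f (mate w u).
  by exists (fun u => N * f u + f (mate w u)).
pose P z := \sum_(u | e w u) A z u * chi u.
pose c := N * (N + 1) * f w.
set Q := \sum_(z | e w z) f z ^+ 2.
set R := \sum_(z | e w z) f z * f (mate w z).
have sumf : \sum_(u | e w u) f u = (N - m) * f w.
  by rewrite -fA big_mkcond; apply: eq_bigr => u _; case: (e w u);
    rewrite ?mul1r ?mul0r.
have sumchi : \sum_(u | e w u) chi u = (N + 1) * (N - m) * f w.
  rewrite (eq_bigr _ (fun u _ => chiE u)) big_split /= -mulr_sumr sum_mate sumf.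
  by ring.
have sumf2M : \sum_(u | e w u) f (mate w u) ^+ 2 = Q.
  exact: (sum_mate w (fun u => f u ^+ 2)).
have sumchi2 : \sum_(u | e w u) chi u ^+ 2 = (N ^+ 2 + 1) * Q + 2 * N * R.
  rewrite (eq_bigr (fun u => N ^+ 2 * f u ^+ 2 + 2 * N * (f u * f (mate w u))
    + f (mate w u) ^+ 2)); last by move=> u _; rewrite chiE; ring.
  by rewrite !big_split /= -!mulr_sumr sumf2M -/Q -/R; ring.
have sumchiM : \sum_(u | e w u) chi u * chi (mate w u) =
    2 * N * Q + (N ^+ 2 + 1) * R.
  rewrite (eq_bigr (fun u => N * f u ^+ 2 + (N ^+ 2 + 1) * (f u * f (mate w u))
    + N * f (mate w u) ^+ 2)); last first.
    by move=> u wu; rewrite !chiE mateK //; ring.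
  by rewrite !big_split /= -!mulr_sumr sumf2M -/Q -/R; ring.
have Pw : P w = \sum_(u | e w u) chi u.
  by apply: eq_bigr => u ->; rewrite mul1r.
have PN z : e w z -> P z = chi (mate w z).
  move=> wz; rewrite /P (bigD1 (mate w z)) ?mate_adjl //= mate_adjr // mul1r.
  rewrite big1 ?addr0 // => u /andP[wu hu].
  by rewrite (adj_mate wz wu) (negPf hu) mul0r.
have sumP : \sum_z P z = k * \sum_(u | e w u) chi u.
  rewrite exchange_big mulr_sumr; apply: eq_bigr => u _.
  rewrite -mulr_suml -(sum_adj u); congr (_ * _).
  by apply: eq_bigr => z _; rewrite eC.
(* Two neighbours of w have k, 1 or mu common neighbours as they are equal, mates at w, or
   neither. *)
have sumP2 : \sum_z P z ^+ 2 = (k - mu) * (\sum_(u | e w u) chi u ^+ 2)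
    + (1 - mu) * (\sum_(u | e w u) chi u * chi (mate w u))
    + mu * (\sum_(u | e w u) chi u) ^+ 2.
  have -> : \sum_z P z ^+ 2 = \sum_(u | e w u) \sum_(v | e w v)
      chi u * chi v * (mu + (k - mu) * (v == u)%:R
                       + (1 - mu) * (v == mate w u)%:R).
    rewrite (eq_bigr (fun z => \sum_(u | e w u) \sum_(v | e w v)
      (chi u * chi v * (A u z * A v z)))); last first.
      move=> z _; rewrite expr2 /P mulr_suml; apply: eq_bigr => u _.
      rewrite mulr_sumr; apply: eq_bigr => v _.
      by rewrite (eC u) (eC v); ring.
    rewrite exchange_big; apply: eq_bigr => u wu.
    rewrite exchange_big; apply: eq_bigr => v wv.
    rewrite -mulr_sumr sum_adj2 (adj_mate wu wv) (eq_sym v u).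
    by congr (_ * _); ring.
  rewrite (eq_bigr (fun u => (k - mu) * chi u ^+ 2 + (1 - mu) *
      (chi u * chi (mate w u)) + mu * chi u * \sum_(v | e w v) chi v)).
    by rewrite !big_split /= -mulr_suml -!mulr_sumr; ring.
  move=> u wu.
  rewrite (eq_bigr (fun v => mu * chi u * chi v
     + (k - mu) * chi u * ((v == u)%:R * chi v)
     + (1 - mu) * chi u * ((v == mate w u)%:R * chi v))); last first.
    by move=> v _; ring.
  have pick i : e w i -> \sum_(v | e w v) (v == i)%:R * chi v = chi i.
    move=> wi; rewrite (bigD1 i) //= eqxx mul1r big1 ?addr0 //.
    by move=> v /andP[_ /negPf->]; rewrite mul0r.
  rewrite !big_split /= -!mulr_sumr !pick ?mate_adjl //; ring.
have sumcP : \sum_z (c + P z) ^+ 2 = m ^+ 2 * c ^+ 2 + 2 * c * \sum_z P z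
    + \sum_z P z ^+ 2.
  rewrite (eq_bigr (fun z => c ^+ 2 * 1 + 2 * c * P z + P z ^+ 2)).
    by rewrite !big_split /= -!mulr_sumr order_rat; ring.
  by move=> z _; ring.
have sumcN : \sum_(z | e w z) (c + P z) ^+ 2 = k * c ^+ 2
    + 2 * c * (\sum_(u | e w u) chi u) + \sum_(u | e w u) chi u ^+ 2.
  rewrite (eq_bigr (fun z => (c + chi (mate w z)) ^+ 2)); last first.
    by move=> z wz; rewrite PN.
  rewrite (sum_mate w (fun z => (c + chi z) ^+ 2)).
  rewrite (eq_bigr (fun z => c ^+ 2 * 1 + 2 * c * chi z + chi z ^+ 2)).
    rewrite !big_split /= -!mulr_sumr -(sum_adj w) big_mkcond /= mulrC.
    by congr (_ * _ + _ + _); apply: eq_bigr => z _; case: (e w z).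
  by move=> z _; ring.
have split3 (F : T -> rat) : \sum_z F z = F w + (\sum_(z | e w z) F z)
    + \sum_(z | (z != w) && ~~ e w z) F z.
  rewrite (bigD1 w) //= -addrA; congr (_ + _).
  rewrite (bigID (e w)) /=; congr (_ + _); apply: eq_bigl => z.
  by case: (eqVneq z w) => [->|//]; rewrite eI.
have far : (N ^+ 2 - 1) ^+ 2 * \sum_(z | (z != w) && ~~ e w z) f z ^+ 2
    = \sum_(z | (z != w) && ~~ e w z) (c + P z) ^+ 2.
  rewrite mulr_sumr; apply: eq_bigr => z /andP[zw nwz].
  have wz : w != z by rewrite eq_sym.
  have := eigenfun_star fE wz nwz; rewrite /comb => h.
  have -> : P z = \sum_(u | e w u && e z u) (N * f u + f (mate w u)).
    rewrite [RHS]big_mkcondr; apply: eq_bigr => u _.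
    by case: (e z u); rewrite ?mul1r ?mul0r ?chiE.
  move: h; set S := \sum_(u | _) _ => h.
  have -> : c + S = - ((N ^+ 2 - 1) * f z) by rewrite -[LHS]subr0 -h /c; ring.
  by ring.
move: (split3 (fun z => (c + P z) ^+ 2)).
rewrite /= sumcP sumP2 sumP sumcN sumchi2 sumchiM Pw sumchi -far => hh.
rewrite (split3 (fun z => f z ^+ 2)) -/Q 2!mulrDr.
move: hh; set X := (N ^+ 2 - 1) ^+ 2 * \sum_(z | _ && _) f z ^+ 2 => hh.
by apply: (eq_of_sub hh); rewrite /c; ring.
Qed.

(** * Overlaps as cardinalities *)

Definition common3 x y z := [set u | [&& e x u, e y u & e z u]].

Definition cross x y z := [set u | [&& e x u, e y u & e z (mate x u)]].

Lemma sum_bool_cond (P Q : pred T) :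
  \sum_(u | P u) (Q u)%:R = #|[set u | P u && Q u]|%:R :> rat.
Proof.
rewrite -sum_bool [LHS]big_mkcond; apply: eq_bigr => u _.
by case: (P u).
Qed.

Lemma common3_sum x y z :
  #|common3 x y z|%:R = \sum_(u | e x u && e y u) A z u.
Proof.
by rewrite sum_bool_cond /common3; congr (_%:R); apply: eq_card => u;
  rewrite !inE andbA.
Qed.

Lemma cross_sum x y z :
  #|cross x y z|%:R = \sum_(u | e x u && e y u) A z (mate x u).
Proof.
by rewrite sum_bool_cond /cross; congr (_%:R); apply: eq_card => u;
  rewrite !inE andbA.
Qed.

Lemma overlap_card x y z :
  overlap x y z = (n * #|common3 x y z| + #|cross x y z|)%:R.
Proof.
rewrite natrD natrM common3_sum cross_sum mulr_sumr -big_split /= big_mkcondr.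
by apply: eq_bigr => u _; case: (e y u); rewrite /= ?mul1r // mul0r.
Qed.

Lemma overlap_adj x y z : ~~ e x y -> ~~ e x z -> x != y -> x != z -> e y z ->
  (n * #|common3 x y z| + #|cross x y z| = n.+1)%N.
Proof.
move=> nxy nxz xy xz yz; apply/eqP; rewrite -(eqr_nat rat) -overlap_card.
have yneqz : y == z = false by apply: contraTF yz => /eqP->; rewrite eI.
by rewrite overlapE // yz yneqz -natr1; apply/eqP => /=; ring.
Qed.

Lemma overlap_nonadj x y z :
  ~~ e x y -> ~~ e x z -> x != y -> x != z -> y != z -> ~~ e y z ->
  (n * #|common3 x y z| + #|cross x y z| = n * n.+1)%N.
Proof.
move=> nxy nxz xy xz yz nyz; apply/eqP; rewrite -(eqr_nat rat) -overlap_card.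
rewrite overlapE // (negPf yz) (negPf nyz) natrM -natr1.
by apply/eqP => /=; ring.
Qed.

(** [overlap x] sees far vertices only through their neighbours around x, and no z other than y
    attains the value of [overlap x y y]. *)
Lemma separation x y z : x != y -> ~~ e x y -> x != z -> ~~ e x z ->
  (forall u, e x u -> e y u = e z u) -> y = z.
Proof.
move=> xy nxy xz nxz h.
have : overlap x y z = overlap x y y.
  by apply: eq_bigr => u xu; rewrite !h // mate_adjl.
rewrite !overlapE // eqxx eI => /addrI/(mulfI N2_neq0).
by move/(delta_subr_eq N_ge3)/eqP.
Qed.

(** These are the totals of a true row f = [gram c] with c adjacent to w: near w, f - n/m is then n
    at c, -1 at the mate of c, and 0 elsewhere. *)
Lemma local_norm_int f w : eigenfun f -> \sum_z f z ^+ 2 = m * N + N ->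
  f w = N / m - 1 ->
  \sum_(z | e w z) (f z - N / m) = N - 1 /\
  N * (\sum_(z | e w z) (f z - N / m) ^+ 2)
   + \sum_(z | e w z) (f z - N / m) * (f (mate w z) - N / m) = N ^+ 3 - N.
Proof.
move=> fE fN fw.
have sumc (c : rat) : \sum_(z | e w z) c = k * c.
  rewrite -(sum_adj w) mulr_suml big_mkcond; apply: eq_bigr => z _.
  by case: (e w z); rewrite ?mul1r ?mul0r.
have sumf : \sum_(u | e w u) f u = (N - m) * (N / m - 1).
  rewrite -fw -(proj2 fE) big_mkcond; apply: eq_bigr => u _.
  by case: (e w u); rewrite ?mul1r ?mul0r.
split; first by rewrite sumrB sumc sumf; field.
have := eigenfun_local_norm w fE; rewrite fN fw.
set Q := \sum_(z | e w z) f z ^+ 2.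
set R := \sum_(z | e w z) f z * f (mate w z) => h.
rewrite (eq_bigr (fun z => f z ^+ 2 - 2 * (N / m) * f z + (N / m) ^+ 2));
  last by move=> z _; ring.
rewrite [X in _ + X](eq_bigr (fun z => f z * f (mate w z) - (N / m) * f z
  - (N / m) * f (mate w z) + (N / m) ^+ 2)); last by move=> z _; ring.
rewrite !big_split /= !sumrN -!mulr_sumr !sumc sum_mate sumf -/Q -/R.
apply: (mulfI N2_neq0); apply: (mulfI m_neq0).
by apply: (eq_of_sub h); field.
Qed.

Lemma gram_mate x u v :
  e x u -> e x v -> gram (mate x u) (mate x v) = gram u v.
Proof. by move=> xu xv; rewrite /gram adj_mate2 // eq_mate2. Qed.

(** The swap embeds the common neighbours of x and y into those of x and z; both sets have mu
    elements. *)
Lemma reflect_of_cross x y z : x != y -> ~~ e x y -> x != z -> ~~ e x z ->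
  (forall u, e x u -> e y u -> e z (mate x u)) ->
  forall u, e x u -> e z u = e y (mate x u).
Proof.
move=> xy nxy xz nxz h.
have eqS : mate x @: [set u | e x u && e y u] = [set u | e x u && e z u].
  apply/eqP; rewrite eqEcard; apply/andP; split.
    apply/subsetP => _ /imsetP[u + ->]; rewrite !inE => /andP[xu yu].
    by rewrite mate_adjl ?h.
  rewrite card_in_imset ?(srg_nonadj srg) // => u v.
  rewrite !inE => /andP[xu _] /andP[xv _] /eqP; rewrite eq_mate2 //.
  by move/eqP.
move=> u xu; move/setP: eqS => /(_ u); rewrite !inE xu /= => <-.
apply/imsetP/idP => [[v + ->]|hu].
  by rewrite inE => /andP[xv yv]; rewrite mateK.
by exists (mate x u); rewrite ?inE ?mateK // mate_adjl.
Qed.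

(* A weight of total mass n on a set with an involution whose energy is
   nearly maximal is concentrated at a single point. *)
Lemma concentrated (P : pred T) (h : T -> nat) (s : T -> T) (q : nat) :
  (forall z, P z -> P (s z) && (s z != z)) ->
  (\sum_(z | P z) h z = n)%N ->
  (n * (\sum_(z | P z) h z ^ 2) + \sum_(z | P z) h z * h (s z) + 2 * n
    = n ^ 3 + q)%N ->
  exists2 c, P c & h c = n.
Proof.
move=> Ps hn hE; set s2 := (\sum_(z | P z) h z ^ 2)%N in hE.
set r := (\sum_(z | P z) h z * h (s z))%N in hE.
have [c /andP[Pc hc]] : exists c, P c && (0 < h c)%N.
  apply/existsP; apply: contraTT n_gt2 => /existsPn no.
  rewrite -hn big1 // => z Pz; apply/eqP; move: (no z).
  by rewrite Pz -eqn0Ngt.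
exists c => //; move: (hn); rewrite (bigD1 c) //=.
set o := (\sum_(z | _ && _) h z)%N => hco.
have s2r : (s2 + r <= n ^ 2)%N.
  rewrite -big_split /= -mulnn -{1}hn big_distrl /=; apply: leq_sum => z Pz.
  rewrite -mulnn -mulnDr leq_mul2l; apply/orP; right.
  have /andP[Psz szz] := Ps z Pz.
  by rewrite -hn (bigD1 z) //= (bigD1 (s z)) ?Psz //= addnA leq_addr.
have s2c : (s2 <= h c ^ 2 + o ^ 2)%N.
  rewrite /s2 (bigD1 c) //= leq_add2l -[(o ^ 2)%N]mulnn {1}/o big_distrl /=.
  apply: leq_sum => z hz.
  by rewrite -mulnn leq_mul2l /o (bigD1 z) //= leq_addr orbT.
have [o0|o_gt0] := posnP o; first by lia.
move: (h c) (o) hc o_gt0 hco s2c => a b a0 b0 hco s2c.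
exfalso; clear -n_gt2 hE s2r s2c a0 b0 hco.
(* If the mass splits as a + b with both parts positive, the sum of squares is at most n^2 - 2 n +
   2. With [s2r] the energy is at most n^3 - 2 n^2 + 4 n - 2, and adding 2 n stays below n^3 for n
   >= 3. *)
have ab : (n <= a * b + 1)%N by nia.
have s2n : (s2 + 2 * n <= n ^ 2 + 2)%N.
  by rewrite -{2}hco -!mulnn; move: s2c; rewrite -!mulnn; nia.
have k1 : (n * s2 + r + s2 <= n * s2 + n ^ 2)%N by lia.
have k2 : (n * (s2 + 2 * n) <= n * (n ^ 2 + 2))%N by rewrite leq_mul2l s2n orbT.
have [p np] : exists p, n = p.+3 by exists (n - 3)%N; lia.
move: hE s2r s2n k1 k2; rewrite np !expnS !expn0; nia.
Qed.

(** The swapped combination f has the norm of [gram y]. Let w be the mate at x of a common neighbour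
    u0. Near w, f - n/m is a natural weight minus a point mass; the local norm concentrates the
    weight at one vertex, the reflection. *)
Lemma reflection_exists x y : x != y -> ~~ e x y ->
  exists z, [/\ x != z, ~~ e x z & forall u, e x u -> e z u = e y (mate x u)].
Proof.
move=> xy nxy; have yx : y != x by rewrite eq_sym.
have nyx : ~~ e y x by rewrite eC.
have [u0 /andP[xu0 yu0]] : exists u0, e x u0 && e y u0.
  apply/existsP; apply: contraTT n_gt2 => /existsPn no.
  have := srg_nonadj srg xy nxy.
  rewrite (_ : [set z | _] = set0) ?cards0; last first.
    by apply/setP => z; rewrite !inE (negPf (no z)).
  by case: (n).
pose D := N ^+ 2 - 1.
pose psi z := (-1) * (N * (N + 1) * gram x z
  + \sum_(u | e x u && e y u) (N * gram (mate x u) z + gram u z)).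
have psi_eigen : eigenfun psi.
  apply: eigenfunZ; apply: eigenfunD; first exact/eigenfunZ/eigenfun_gram.
  apply: eigenfun_sum => u _; apply: eigenfunD; last exact: eigenfun_gram.
  exact/eigenfunZ/eigenfun_gram.
have comb0 z : D * gram y z = (-1) * (N * (N + 1) * gram x z
    + \sum_(u | e x u && e y u) (N * gram u z + gram (mate x u) z)).
  by have := comb_gram_eq0 xy nxy z; rewrite /comb /D => h; lra.
have gramM v u : e x u -> e x v -> gram (mate x u) v = gram u (mate x v).
  by move=> xu xv; rewrite -{1}(mateK xv) gram_mate ?mate_adjl.
have gramx v : e x v -> gram x (mate x v) = gram x v.
  move=> xv; rewrite /gram mate_adjl // xv.
  have -> : v == x = false by apply: contraTF xv => /eqP->; rewrite eI.
  have -> // : mate x v == x = false.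
  by apply: contraTF (mate_adjl xv) => /eqP->; rewrite eI.
have psiN v : e x v -> psi v = D * gram y (mate x v).
  move=> xv; rewrite comb0 gramx //; congr (_ * (_ + _)).
  apply: eq_bigr => u /andP[xu _].
  by rewrite gramM // [in RHS]gramM ?mate_adjl // mateK.
have psix : psi x = D * gram y x.
  rewrite comb0; congr (_ * (_ + _)); apply: eq_bigr => u /andP[xu _].
  rewrite -[gram (mate x u) x]gramC -[gram u x]gramC.
  by rewrite !gramx.
pose f z := D^-1 * psi z.
have f_eigen : eigenfun f by apply: eigenfunZ.
have fx : f x = gram y x by rewrite /f psix mulKf.
have fN v : e x v -> f v = gram y (mate x v).
  by move=> xv; rewrite /f psiN // mulKf.
(* Pairing f with its own expansion uses only its values at x and near x, where they are those of
   [gram y] after the swap. *)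
have f_norm : \sum_z f z ^+ 2 = m * N + N.
  have -> : m * N + N = m * gram y y by rewrite /gram eqxx eI /=; field.
  have -> : \sum_z f z ^+ 2 = D^-1 * ((-1) * (N * (N + 1) * (m * f x)
    + \sum_(u | e x u && e y u) (N * (m * f (mate x u)) + m * f u))).
    rewrite -!(gram_reproducing _ f_eigen).
    under [X in _ + X]eq_bigr => u _ do
      rewrite -!(gram_reproducing _ f_eigen) [N * _]mulr_sumr -big_split.
    rewrite exchange_big [X in X + _]mulr_sumr -big_split !mulr_sumr.
    apply: eq_bigr => z _ /=; rewrite expr2 {1}/f /psi -!mulrA.
    congr (_ * (_ * _)).
    rewrite mulrDl mulr_suml -!mulrA; congr (_ + _).
    by apply: eq_bigr => u _; rewrite mulrDl mulrA.
  apply: (mulfI N2_neq0); rewrite -/D mulVKf // [RHS]mulrCA comb0 [RHS]mulrCA.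
  congr (_ * _); rewrite [RHS]mulrDr mulr_sumr fx; congr (_ + _).
    by rewrite gramC; ring.
  apply: eq_bigr => u /andP[xu yu]; rewrite !fN ?mate_adjl // mateK //.
  by rewrite !(gramC y); ring.
set w := mate x u0; have xw : e x w by exact: mate_adjl.
have wx : e w x by rewrite eC.
have wu0 : e w u0 by rewrite eC mate_adjr.
have nyw : ~~ e y w by rewrite nonadj_mate.
have yw : y != w by apply: contraNneq nxy => ->.
have fw : f w = N / m - 1.
  rewrite fN // mateK // /gram yu0.
  have -> : u0 == y = false by apply: contraTF yu0 => /eqP->; rewrite eI.
  by rewrite /=; ring.
have [sumg normg] := local_norm_int f_eigen f_norm fw.
have near z : e w z -> z != x -> z != u0 -> (x != z) && ~~ e x z.
  move=> wz zx zu0; rewrite eq_sym zx /=; apply: contra zu0 => xz.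
  by rewrite (mate_uniq xw xz wz) mateK.
have ff z : e w z -> z != x -> z != u0 ->
    D * f z = (n * #|cross x y z| + #|common3 x y z|)%:R
              - N ^+ 2 * (N + 1) * (N + 2) / m.
  move=> wz zx zu0; have /andP[xz nxz] := near z wz zx zu0.
  rewrite /f mulVKf // /psi natrD natrM common3_sum cross_sum.
  rewrite (eq_bigr (fun u => (N + 1) * (N / m)
    - (N * A z (mate x u) + A z u))); last first.
    move=> u /andP[xu _]; rewrite /gram (eC u) (eC _ z).
    have -> : z == u = false by apply: contraNF nxz => /eqP->.
    have -> : z == mate x u = false.
      by apply: contraNF nxz => /eqP->; apply: mate_adjl.
    by rewrite /=; ring.
  rewrite sumrB sum_common // big_split /= -mulr_sumr /gram (negPf zx).
  by rewrite (negPf nxz) /=; field.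
(* At y, the overlap of the adjacent vertices x and w is n + 1, of which u0 accounts for n. *)
have [v0 cr] : exists v0, cross y x w = [set v0].
  have c3 : common3 y x w = [set u0].
    apply/setP => u; rewrite !inE; apply/and3P/eqP => [[yu xu wu]|-> //].
    by rewrite (mate_uniq xw xu wu) mateK.
  have := overlap_adj nyx nyw yx yw xw; rewrite c3 cards1 muln1 -addn1.
  by move/addnI/eqP/cards1P.
have [yv0 xv0 wz0] : [/\ e y v0, e x v0 & e w (mate y v0)].
  by apply/and3P; have : v0 \in cross y x w by [rewrite cr set11]; rewrite inE.
(* Among the common neighbours of w and y other than u0, only z0 has a common neighbour with both x
   and y; there f - n/m is -1. *)
set z0 := mate y v0 in wz0.
have yz0 : e y z0 by exact: mate_adjl.
have xz0 : e x z0 = false by exact: nonadj_mate.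
have z0x : x == z0 = false by apply: contraTF yz0 => /eqP<-.
have z0u : u0 == z0 = false by apply: contraFF xz0 => /eqP<-.
(* If z is not adjacent to y, the overlap makes [cross x y z] of size n (j + 1) for some j, and f -
   n/m is then j; hence the predecessor. *)
pose h z := if [|| z == x, z == u0 | e y z] then 0%N
  else (#|cross x y z| %/ n).-1.
have cross_gt0 z : e w z -> (0 < #|cross x y z|)%N.
  by move=> wz; apply/card_gt0P; exists u0; rewrite inE xu0 yu0 eC.
have n_gt0 : (0 < n)%N by rewrite (leq_trans _ n_gt2).
have ffE z q : e w z -> z != x -> z != u0 ->
    D * q = (n * #|cross x y z| + #|common3 x y z|)%:R - (N + 1) - D ->
    f z - N / m = q.
  move=> wz zx zu0 hq; apply: (mulfI N2_neq0); rewrite -/D hq mulrBr ff //.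
  by rewrite /D; field.
have gE z : e w z -> f z - N / m = (h z)%:R - (z == z0)%:R.
  move=> wz; rewrite /h.
  have [->|zx] := eqVneq z x.
    by rewrite fx z0x /gram (negPf xy) (negPf nyx) /=; ring.
  have [->|zu0] := eqVneq z u0.
    by rewrite fN // -/w z0u /gram eq_sym (negPf yw) (negPf nyw) /=; ring.
  have /andP[xz nxz] := near z wz zx zu0; have b_gt0 := cross_gt0 z wz.
  rewrite /=; case: (boolP (e y z)) => yz.
    have ab := overlap_adj nxy nxz xy xz yz.
    have [zz0|zz0] := eqVneq z z0.
      have a_gt0 : (0 < #|common3 x y z|)%N.
        by apply/card_gt0P; exists v0; rewrite inE xv0 yv0 zz0 eC mate_adjr.
      apply: ffE => //.
      have [-> ->] := muln_add_eqS n_gt2 a_gt0 b_gt0 ab.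
      by rewrite /D muln1 natrD /=; ring.
    have a0 : #|common3 x y z| = 0%N.
      apply/eqP; apply: contraNT zz0; rewrite -lt0n => /card_gt0P[v].
      rewrite inE => /and3P[xv yv zv].
      have zE : z = mate y v by apply: mate_uniq; rewrite // eC.
      have : v \in cross y x w by rewrite inE yv xv -zE.
      by rewrite cr inE => /eqP vv0; rewrite zE vv0.
    apply: ffE => //; move: ab; rewrite a0 muln0 add0n => ->.
    by rewrite /D addn0 natrM -natr1 /=; ring.
  have yneqz : y != z by apply: contraNneq nyw => ->; rewrite eC.
  have zz0 : z == z0 = false by apply: contraNF yz => /eqP->.
  have ab := overlap_nonadj nxy nxz xy xz yneqz yz.
  have /dvdnP[j bj] : (n %| #|cross x y z|)%N.
    rewrite -(dvdn_addr _ (dvdn_mulr #|common3 x y z| (dvdnn n))) ab.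
    exact: dvdn_mulr.
  rewrite zz0 bj mulnK //; apply: ffE => //; move: ab b_gt0; rewrite bj.
  case: j bj => [|j] _; first by rewrite mul0n.
  rewrite (mulnC _ n) /= => + _.
  rewrite -mulnDr => /eqP; rewrite eqn_pmul2l // addnS eqSS => /eqP aj.
  have -> : #|common3 x y z| = (n - j)%N by rewrite -aj addnK.
  have jn : (j <= n)%N by rewrite -aj leq_addl.
  by rewrite natrD natrB // !natrM -natr1 /D /=; ring.
have hz0 : h z0 = 0%N by rewrite /h yz0 !orbT.
have wMz0 : e w (mate w z0) by exact: mate_adjl.
have Mz0 : mate w z0 == z0 = false.
  by apply: contraTF (mate_adjr wz0) => /eqP->; rewrite eI.
have sumh : (\sum_(z | e w z) h z)%N = n.
  apply/eqP; rewrite -(eqr_nat rat) natr_sum; apply/eqP.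
  have := sumg; rewrite (eq_bigr _ gE) sumrB sum_indicator //.
  by move/addIr.
have sumg2 : \sum_(z | e w z) (f z - N / m) ^+ 2
    = \sum_(z | e w z) (h z ^ 2)%:R + 1.
  rewrite (eq_bigr (fun z => (h z ^ 2)%:R + (z == z0)%:R)) => [|z wz].
    by rewrite big_split /= sum_indicator.
  by rewrite gE // natrX; case: eqVneq => [->|_] /=; rewrite ?hz0; ring.
have sumgM : \sum_(z | e w z) (f z - N / m) * (f (mate w z) - N / m)
    = \sum_(z | e w z) (h z * h (mate w z))%:R - 2 * (h (mate w z0))%:R.
  rewrite (eq_bigr (fun z => (h z * h (mate w z))%:R
    - (h (mate w z0))%:R * (z == z0)%:R
    - (h (mate w z0))%:R * (z == mate w z0)%:R)) => [|z wz].
    by rewrite !sumrB -!mulr_sumr !sum_indicator //; ring.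
  rewrite !gE ?mate_adjl // natrM.
  have -> : (mate w z == z0) = (z == mate w z0).
    by rewrite -{1}(mateK wz0) eq_mate2.
  case: (eqVneq z z0) => [->|_]; first by rewrite eq_sym Mz0 hz0 /=; ring.
  by case: (eqVneq z (mate w z0)) => [->|_]; rewrite ?mateK ?hz0 //=; ring.
have normh : (n * (\sum_(z | e w z) h z ^ 2)
    + \sum_(z | e w z) h z * h (mate w z) + 2 * n
    = n ^ 3 + 2 * h (mate w z0))%N.
  apply/eqP; rewrite -(eqr_nat rat) !natrD natrX !natrM !natr_sum; apply/eqP.
  move: normg; rewrite sumg2 sumgM => normg.
  by apply: (eq_of_sub (esym normg)); ring.
have [c wc hc] : exists2 c, e w c & h c = n.
  apply: (concentrated (s := mate w) _ sumh normh) => z wz.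
  rewrite mate_adjl //=; apply: contraTneq (mate_adjr wz) => ->.
  by rewrite eI.
move: hc; rewrite /h; case: ifP => [_ n0|]; first by rewrite -n0 in n_gt0.
move/negbT; rewrite !negb_or => /and3P[cx cu0 nyc] hc.
have /andP[xc nxc] := near c wc cx cu0.
have yc : y != c by apply: contraNneq nyw => ->; rewrite eC.
have ab := overlap_nonadj nxy nxc xy xc yc nyc.
(* [h c = n] gives [cross x y c] at least n (n + 1) elements, hence every common neighbour of x and
   y. *)
have cE : cross x y c = [set u | e x u && e y u].
  apply/eqP; rewrite eqEcard; apply/andP; split.
    by apply/subsetP => u; rewrite !inE => /and3P[-> ->].
  rewrite (srg_nonadj srg) //; move: hc.
  case bn : (_ %/ n)%N => [|b] /= hb; first by rewrite -hb in n_gt0.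
  by rewrite addn1 -[X in (_ * X.+1)%N]hb -bn mulnC leq_trunc_div.
exists c; split=> //; apply: (reflect_of_cross xy nxy xc nxc) => u xu yu.
have : u \in cross x y c by rewrite cE inE xu.
by rewrite inE => /and3P[].
Qed.

(** ** Reflections as automorphisms *)

(** The reflection of y in x. By [reflection_exists] the default is never taken. *)
Definition flip x y :=
  if y == x then x else if e x y then mate x y else
  odflt x [pick z | [&& x != z, ~~ e x z
                     & [forall (u | e x u), e z u == e y (mate x u)]]].

Lemma flip_id x : flip x x = x.
Proof. by rewrite /flip eqxx. Qed.

Lemma flip_adj x y : e x y -> flip x y = mate x y.
Proof.
by move=> xy; rewrite /flip xy; case: eqP xy => // ->; rewrite eI.
Qed.

Lemma flip_nonadj x y : x != y -> ~~ e x y ->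
  [/\ x != flip x y, ~~ e x (flip x y)
    & forall u, e x u -> e (flip x y) u = e y (mate x u)].
Proof.
move=> xy nxy; have yx : y == x = false by rewrite eq_sym (negPf xy).
rewrite /flip yx (negPf nxy).
case: pickP => /= [z /and3P[xz nxz /forall_inP h]|no].
  by split=> // u /h /eqP.
have [z [xz nxz h]] := reflection_exists xy nxy.
have := no z; rewrite xz nxz /= => /forall_inP[] u xu; apply/eqP; exact: h.
Qed.

Lemma flip_unique x y z : x != y -> ~~ e x y -> x != z -> ~~ e x z ->
  (forall u, e x u -> e z u = e y (mate x u)) -> flip x y = z.
Proof.
move=> xy nxy xz nxz h; have [x1 x2 x3] := flip_nonadj xy nxy.
by apply: (separation x1 x2 xz nxz) => u xu; rewrite x3 ?h.
Qed.

Variant position x : T -> Prop :=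
| PositionSame : position x x
| PositionAdj y of e x y : position x y
| PositionFar y of x != y & ~~ e x y : position x y.

Lemma positionP x y : position x y.
Proof.
have [<-|xy] := eqVneq x y; first by constructor.
by case: (boolP (e x y)); [constructor 2|constructor 3].
Qed.

Lemma flipK x : involutive (flip x).
Proof.
move=> y; case: {y}(positionP x y) => [|y xy|y xy nxy].
- by rewrite !flip_id.
- by rewrite (flip_adj xy) flip_adj ?mate_adjl ?mateK.
have [x1 x2 x3] := flip_nonadj xy nxy.
by apply: flip_unique => // u xu; rewrite x3 ?mate_adjl ?mateK.
Qed.

Lemma adj_flip_center x y : e x (flip x y) = e x y.
Proof.
case: {y}(positionP x y) => [|y xy|y xy nxy].
- by rewrite flip_id.
- by rewrite flip_adj // mate_adjl.
by have [_ /negPf-> _] := flip_nonadj xy nxy; apply/esym/negbTE.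
Qed.

(** For two vertices far from x, the swap reindexes [overlap x], whose value determines
    adjacency. *)
Lemma adj_flip x y z : e (flip x y) (flip x z) = e y z.
Proof.
have near_far u v : e x u -> x != v -> ~~ e x v ->
    e (flip x v) (flip x u) = e v u.
  move=> xu xv nxv; have [_ _ h] := flip_nonadj xv nxv.
  by rewrite (flip_adj xu) h ?mate_adjl // mateK.
case: {y}(positionP x y) => [|y xy|y xy nxy].
- by rewrite flip_id adj_flip_center.
- case: {z}(positionP x z) => [|z xz|z xz nxz].
  + by rewrite flip_id eC adj_flip_center eC.
  + by rewrite !flip_adj // adj_mate2.
  + by rewrite eC near_far // eC.
case: {z}(positionP x z) => [|z xz|z xz nxz].
- by rewrite flip_id eC adj_flip_center eC.
- exact: near_far.
have [x1 x2 x3] := flip_nonadj xy nxy; have [z1 z2 z3] := flip_nonadj xz nxz.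
have eqo : overlap x (flip x y) (flip x z) = overlap x y z.
  rewrite /overlap -[RHS]sum_mate; apply: eq_bigr => u xu.
  by rewrite x3 // !z3 ?mate_adjl // mateK.
move: eqo; rewrite !overlapE // (inj_eq (inv_inj (flipK x))).
move=> /addrI/(mulfI N2_neq0)/addrI/oppr_inj/eqP; rewrite eqr_nat.
by case: (e _ _) (e y z) => [] [].
Qed.

Lemma card_common x y : x != y -> ~~ e x y ->
  #|[set u | e x u && e y u]| = (n * n.+1)%N.
Proof. by move=> xy nxy; rewrite (srg_nonadj srg) // addn1. Qed.

(** Let z be the reflection of a far y in x. No vertex is adjacent to x, y and z. Overlaps at x
    exclude an edge from y to z; overlaps at y then make [cross y x z] full, so z is the reflection
    of x in y. *)
Lemma flipC x y : flip x y = flip y x.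
Proof.
case: {y}(positionP x y) => [|y xy|y xy nxy] //.
  have yx : e y x by rewrite eC.
  by rewrite (flip_adj xy) (flip_adj yx) (mateC xy).
have [xz nxz zE] := flip_nonadj xy nxy; set z := flip x y in xz nxz zE *.
have yx : y != x by rewrite eq_sym.
have nyx : ~~ e y x by rewrite eC.
have no3 u : e x u -> e y u -> e z u = false.
  by move=> xu yu; rewrite zE // nonadj_mate.
have [v /andP[xv yv]] : exists v, e x v && e y v.
  have : (0 < #|[set u | e x u && e y u]|)%N.
    by rewrite card_common // muln_gt0 (leq_trans _ n_gt2).
  by case/card_gt0P => v; rewrite inE; exists v.
have yz : y != z by apply: contraTneq (yv) => yz; rewrite {1}yz no3.
have c30 : common3 x y z = set0.
  apply/setP => u; rewrite !inE; apply/negbTE/negP => /and3P[xu yu].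
  by rewrite no3.
have nyz : ~~ e y z.
  apply/negP => yz'; have := overlap_adj nxy nxz xy xz yz'.
  (* [cross x y z] contains all n (n + 1) common neighbours, while an edge would leave room for n +
     1. *)
  have -> : #|cross x y z| = (n * n.+1)%N.
    rewrite -(card_common xy nxy); apply: eq_card => u; rewrite !inE.
    case xu: (e x u); case yu: (e y u) => //=.
    by rewrite zE ?mate_adjl // mateK // yu.
  rewrite c30 cards0 muln0 add0n => h.
  have := leq_mul (ltnW n_gt2) (leqnn n.+1); rewrite h.
  by rewrite mul2n -addnn -{3}[n.+1]addn0 leq_add2l.
apply/esym/flip_unique => //; apply: reflect_of_cross => //.
have c30' : common3 y x z = set0.
  apply/setP => u; move/setP/(_ u): c30; rewrite !inE => <-.
  by rewrite andbCA.
have := overlap_nonadj nyx nyz yx yz xz nxz.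
rewrite c30' cards0 muln0 add0n -(card_common yx nyx) => hc.
have cE : cross y x z = [set u | e y u && e x u].
  apply/eqP; rewrite eqEcard hc leqnn andbT.
  by apply/subsetP => u; rewrite !inE => /and3P[-> ->].
move=> u yu xu; have : u \in cross y x z by rewrite cE inE yu.
by rewrite inE => /and3P[].
Qed.

(** ** Translations *)

(* In the actual graphs, Cayley graphs of elementary abelian 3-groups, these
   are the translations by the elements of the connection set. *)
Definition translations := [set g : {perm T} |
  [forall x, forall y, e (g x) (g y) == e x y] && [forall z, e z (g z)]].

Lemma translation_adj g x y : g \in translations -> e (g x) (g y) = e x y.
Proof.
by rewrite inE => /andP[/forallP/(_ x)/forallP/(_ y)/eqP].
Qed.

Lemma translation_move g x : g \in translations -> e x (g x).
Proof. by rewrite inE => /andP[_ /forallP]. Qed.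

Lemma translation_mate g x u : g \in translations -> e x u ->
  g (mate x u) = mate (g x) (g u).
Proof.
move=> gT xu; apply: mate_uniq; rewrite translation_adj //.
  exact: mate_adjl.
exact: mate_adjr.
Qed.

(** With b the mate of g x at x, the vertex g b is adjacent to g x and to b, so it is x: g rotates
    the triangle. *)
Lemma translation2 g x : g \in translations -> g (g x) = mate x (g x).
Proof.
move=> gT; have xg := translation_move x gT.
have xb := mate_adjl xg; set b := mate x (g x) in xb *.
have gb : g b = x.
  have ab : e (g x) b by exact: mate_adjr.
  rewrite -(mate_mate xg) -/b [RHS]mateC 1?eC //; apply: mate_uniq => //.
    by rewrite translation_adj.
  exact: translation_move.
have := translation_mate gT xb; rewrite {1}/b mateK // gb => ->.
by rewrite /b (mateC xg).
Qed.

Lemma translation3 g x : g \in translations -> g (g (g x)) = x.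
Proof.
move=> gT; have xg := translation_move x gT.
rewrite (translation2 (g x) gT) (translation2 x gT) (mateC xg) mateK //.
by rewrite eC.
Qed.

(** d lies in [cross a c (mate x c)]. The overlap is n + 1 and the common neighbour x takes n of it,
    so one element is left. With a = g x and c = u this determines g u for a translation g. *)
Lemma transport_unique x a c d d' :
  e x a -> e x c -> c != a -> c != mate x a ->
  e a d -> e c d -> e (mate a d) (mate x c) ->
  e a d' -> e c d' -> e (mate a d') (mate x c) -> d = d'.
Proof.
move=> xa xc ca cMa ad cd h ad' cd' h'.
have ac : a != c by rewrite eq_sym.
have nac : ~~ e a c by rewrite (adj_mate xa xc).
have az : a != mate x c by apply: contraNneq cMa => ->; rewrite mateK.
have naz : ~~ e a (mate x c).
  by rewrite (adj_mate xa (mate_adjl xc)) eq_mate2.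
have := overlap_adj nac naz ac az (mate_adjr xc).
have c3 : (0 < #|common3 a c (mate x c)|)%N.
  by apply/card_gt0P; exists x; rewrite inE eC xa eC xc eC mate_adjl.
move=> ov; have c1 : (#|cross a c (mate x c)| <= 1)%N.
  rewrite -(leq_add2l n) addn1 -ov leq_add2r.
  by rewrite -{1}(muln1 n) leq_mul2l c3 orbT.
by move/card_le1_eqP: c1; apply; rewrite inE ?ad ?cd ?ad' ?cd' eC.
Qed.

Lemma translation_eq g h x :
  g \in translations -> h \in translations -> g x = h x -> g = h.
Proof.
move=> gT hT gh; have xg := translation_move x gT.
have ghN u : e x u -> g u = h u.
  move=> xu; have [->|ua] := eqVneq u (g x).
    by rewrite [in RHS]gh !translation2 // gh.
  have [->|ub] := eqVneq u (mate x (g x)).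
    transitivity x; first by rewrite -(translation2 x gT) translation3.
    by rewrite gh -(translation2 x hT) translation3.
  apply: (transport_unique xg xu ua ub).
  - by rewrite translation_adj.
  - exact: translation_move.
  - by rewrite -translation_mate // eC translation_move.
  - by rewrite gh translation_adj.
  - exact: translation_move.
  - by rewrite gh -translation_mate // eC translation_move.
apply/permP => y; case: {y}(positionP x y) => [|y xy|y xy nxy] //.
  exact: ghN.
apply: (@separation (g x)).
- by rewrite (inj_eq perm_inj).
- by rewrite translation_adj.
- by rewrite gh (inj_eq perm_inj).
- by rewrite gh translation_adj.
move=> v; rewrite -(permKV g v) translation_adj // => xu.
by rewrite translation_adj // ghN // translation_adj.
Qed.

(** Both sides solve [transport_unique] for a = h x and c = g x; the two positions it excludes are
    treated first. *)
Lemma translationC g h x :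
  g \in translations -> h \in translations -> g (h x) = h (g x).
Proof.
move=> gT hT; have xg := translation_move x gT.
have xh := translation_move x hT.
have [gh|gh] := eqVneq (g x) (h x); first by rewrite (translation_eq gT hT gh).
have [gMh|gMh] := eqVneq (g x) (mate x (h x)).
  rewrite gMh -(translation2 _ hT) translation3 //.
  by rewrite -(mateK xh) -gMh -(translation2 _ gT) translation3.
apply: (transport_unique xh xg gh gMh).
- exact: translation_move.
- by rewrite translation_adj.
- by rewrite -translation2 // -translation2 // !translation_adj // eC.
- by rewrite translation_adj.
- exact: translation_move.
- by rewrite -translation_mate // eC translation_move.
Qed.

(** Reflect in x, then in b. With z' = [flip x z], [flipC] makes z and its image the images of the
    adjacent vertices x and b under [flip z']. *)
Lemma translation_exists x a : e x a -> exists2 g, g \in translations & g x = a.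
Proof.
move=> xa; set b := mate x a; have xb : e x b by exact: mate_adjl.
have inj : injective (flip b \o flip x).
  by apply: inj_comp; apply: inv_inj; apply: flipK.
exists (perm inj); last first.
  by rewrite permE /= flip_id flip_adj 1?eC // -mateC // mateK.
rewrite inE; apply/andP; split.
  by apply/forallP => y; apply/forallP => z; rewrite !permE /= !adj_flip.
apply/forallP => z; rewrite permE /= -{1}(flipK x z).
by rewrite (flipC x (flip x z)) (flipC b) adj_flip.
Qed.

Lemma order_pow3 : exists r, #|T| = (3 ^ r)%N.
Proof.
pose K := <<translations>>%G.
have KC : abelian K.
  rewrite abelian_gen; apply/centsP => g gT h hT; apply/permP => x.
  by rewrite !permM translationC.
have K3 : (3.-group K)%g.
  apply: (pgroupS (G := 'O_3(K)%G)); last exact: pcore_pgroup.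
  rewrite gen_subG; apply/subsetP => g gT.
  (* In an abelian group the elements of 3-power order lie in the 3-core, so the generators do. *)
  have K3Hall := nilpotent_pcore_Hall 3%N (abelian_nil KC).
  rewrite (mem_normal_Hall K3Hall) ?pcore_normal //.
    rewrite /p_elt; apply: (pnat_dvd (n := 3%N)) => //.
    rewrite order_dvdn; apply/eqP/permP => x.
    by rewrite !expgS expg0 !permM !perm1 translation3.
  exact: (subsetP (subset_gen translations) g gT).
have [x0 _] : exists x0 : T, true.
  have : (0 < #|T|)%N.
    rewrite (srg_order srg) expn_gt0 subn_gt0 orbF.
    rewrite (leq_trans _ (leq_addl _ _)) //.
    by rewrite (leq_trans _ (leq_mul (leqnn 3) n_gt2)).
  by case/card_gt0P => x0; exists x0.
(* Orbits are closed under adjacency, and any two vertices are at distance at most 2, so the action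
   is transitive. *)
have step x y : x \in orbit 'P%act K x0 -> e x y -> y \in orbit 'P%act K x0.
  move=> xO xy; have [g gT <-] := translation_exists xy.
  apply: orbit_trans xO; apply: (mem_orbit 'P%act).
  exact: (subsetP (subset_gen translations) g gT).
have orbT' : orbit 'P%act K x0 = setT.
  apply/setP => y; rewrite inE; case: {y}(positionP x0 y) => [|y xy|y xy nxy].
  - exact: orbit_refl.
  - exact: step (orbit_refl _ _ _) xy.
  have : (0 < #|[set u | e x0 u && e y u]|)%N.
    by rewrite card_common // muln_gt0 (leq_trans _ n_gt2).
  case/card_gt0P => u; rewrite inE => /andP[xu yu].
  by apply: step (step _ _ (orbit_refl _ _ _) xu) _; rewrite eC.
have : (3.-nat #|T|)%N.
  by rewrite -cardsT -orbT' (pnat_dvd (dvdn_orbit _ _ _)).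
by case/p_natP => r ->; exists r.
Qed.

End Graph.

Theorem theorem1 (n : nat) (hn : 0 < n)
  (hsrg : exists (T : finType) (e : rel T),
     strongly_regular e ((n ^ 2 + 3 * n - 1) ^ 2) (n ^ 2 * (n + 3))
       1 (n * (n + 1))) :
  n \in [:: 1; 2; 4].
Proof.
have [n_gt2|] := ltnP 2 n; last by case: n hn {hsrg} => [|[|[|]]].
have [T [e srg]] := hsrg; have [r vr] := order_pow3 n_gt2 srg.
have /(dvdn_pfactor _ _ (isT : prime 3)) [t _ mt] :
    n ^ 2 + 3 * n - 1 %| 3 ^ r.
  by rewrite -vr (srg_order srg) dvdn_exp.
exact: quadratic_pow3 hn mt.
Qed.
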